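(* Let $\mathrm{M}(H;X)$ denote the matching polynomial of hypergraphs. Then $\mathrm{M}$ is weakly distinguishing on hypergraphs and on $r$-uniform hypergraphs for $r\ge 3$, that is: (i) $$\lim_{n\to\infty}\frac{\mathcal{U}_{\mathrm{M}}(n)}{\mathcal{H}(n)}=0.$$ (ii) For every integer $r\ge 3$, $$\lim_{n\to\infty}\frac{\mathcal{U}^r_{\mathrm{M}}(n)}{\mathcal{H}^r(n)}=0.$$
   Context: A (finite) hypergraph $H$ consists of a finite vertex set $V(H)$ and a set $E(H)$ of subsets of $V(H)$, called hyperedges. $H$ is $r$-uniform if every hyperedge has exactly $r$ elements. Two hypergraphs are isomorphic if there is a bijection between their vertex sets under which a set of vertices is a hyperedge of the first iff its image is a hyperedge of the second. A $k$-matching of $H$ is a set $m\subseteq E(H)$ of $k$ (pairwise) disjoint hyperedges, and $\mu_k(H)$ is the number of $k$-matchings of $H$. For $H$ with $n$ vertices the matching polynomial is $\mathrm{M}(H;X)=\sum_{k=1}^{\lfloor n/k_H\rfloor}\mu_k(H)\,X^k$, where $k_H$ is the minimum size of the hyperedges in $E(H)$. (When $E(H)=\emptyset$ or $k_H=0$, so that the upper limit is not defined, the sum is taken over all $k\ge 1$; it has only finitely many nonzero terms.) For a univariate hypergraph polynomial $P$ (an isomorphism-invariant map from hypergraphs to $\mathbb{Z}[X]$): a hypergraph $H$ is $P$-unique if every hypergraph $H_1$ with $P(H_1;X)=P(H;X)$ is isomorphic to $H$; an $r$-uniform hypergraph $H$ is $r$-$P$-unique if every $r$-uniform hypergraph $H_1$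 with $P(H_1;X)=P(H;X)$ is isomorphic to $H$. $\mathcal{H}(n)$ (resp. $\mathcal{H}^r(n)$) is the number of non-isomorphic hypergraphs (resp. $r$-uniform hypergraphs) on $n$ vertices. $\mathcal{U}_P(n)$ is the number of non-isomorphic $P$-unique hypergraphs on $n$ vertices, and $\mathcal{U}^r_P(n)$ is the number of non-isomorphic $r$-$P$-unique $r$-uniform hypergraphs on $n$ vertices. *)

(* Defs.v *)
From mathcomp Require Import all_boot all_order all_algebra.
From mathcomp Require Import all_classical all_reals all_analysis.

Set Implicit Arguments.
Unset Strict Implicit.
Unset Printing Implicit Defensive.

Import Order.TTheory GRing.Theory Num.Theory.
Import numFieldNormedType.Exports.

Local Open Scope ring_scope.

Record hypergraph := Hypergraph {
  vertex : finType;
  edges : {set {set vertex}} }.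

Definition uniform (r : nat) (H : hypergraph) : bool :=
  [forall e in edges H, #|e| == r].

Definition isomorphic (H1 H2 : hypergraph) : Prop :=
  exists2 f : vertex H1 -> vertex H2, bijective f &
    forall e : {set vertex H1}, (e \in edges H1) = (f @: e \in edges H2).

Definition matchings (H : hypergraph) (k : nat) : {set {set {set vertex H}}} :=
  [set m : {set {set vertex H}} |
    [&& m \subset edges H, #|m| == k & finset.trivIset m]].

Definition num_matchings (H : hypergraph) (k : nat) : nat := #|matchings H k|.

(* No hyperedge has more than #|vertex H| elements, so starting the minimum
   there is harmless as soon as there is at least one hyperedge. *)
Definition min_edge_size (H : hypergraph) : nat :=
  \big[minn/#|vertex H|]_(e in edges H) #|e|.

(* If there is no hyperedge, or if the empty set is a hyperedge, the quotient
   n / k_H makes no sense and the sum runs over all k >= 1; its terms vanish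
   beyond k = #|edges H|, since a k-matching is a set of k hyperedges. *)
Definition matching_bound (H : hypergraph) : nat :=
  if (edges H == finset.set0) || (min_edge_size H == 0)%N then #|edges H|
  else (#|vertex H| %/ min_edge_size H)%N.

Definition matching_poly (H : hypergraph) : {poly int} :=
  \sum_(1 <= k < (matching_bound H).+1) (num_matchings H k)%:R *: 'X^k.

Definition unique_for (P : hypergraph -> {poly int}) (H : hypergraph) : Prop :=
  forall H1 : hypergraph, P H1 = P H -> isomorphic H1 H.

(* Only applied to r-uniform H. *)
Definition runique_for (r : nat) (P : hypergraph -> {poly int})
    (H : hypergraph) : Prop :=
  forall H1 : hypergraph, uniform r H1 -> P H1 = P H -> isomorphic H1 H.

(* Every hypergraph on n vertices has a copy on 'I_n, so the non-isomorphic
   ones are counted as the isomorphism classes of those on 'I_n. *)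
Definition hyp_on (n : nat) (E : {set {set 'I_n}}) : hypergraph :=
  @Hypergraph 'I_n E.

Definition num_iso_classes (n : nat) (Q : hypergraph -> Prop) : nat :=
  #|equivalence_partition
      (fun E F : {set {set 'I_n}} => `[< isomorphic (hyp_on E) (hyp_on F) >])
      [set E : {set {set 'I_n}} | `[< Q (hyp_on E) >]]%SET|.

Definition num_hyp (n : nat) : nat := num_iso_classes n (fun=> True).

Definition num_runiform (r n : nat) : nat :=
  num_iso_classes n (fun H => uniform r H).

Definition num_unique (P : hypergraph -> {poly int}) (n : nat) : nat :=
  num_iso_classes n (fun H => unique_for P H).

Definition num_runique (r : nat) (P : hypergraph -> {poly int}) (n : nat) : nat :=
  num_iso_classes n (fun H => uniform r H /\ runique_for r P H).

(* Main.v *)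
Require Import Defs.
From mathcomp Require Import all_boot all_order all_algebra.
From mathcomp Require Import all_classical all_reals all_analysis.
From mathcomp Require Import zify.

Set Implicit Arguments.
Unset Strict Implicit.
Unset Printing Implicit Defensive.

(** There are far too few matching polynomials for all the hypergraphs.

    Pairwise non-isomorphic M-unique hypergraphs have pairwise distinct matching
    polynomials, so there are at most as many of them on n vertices as there are
    matching polynomials of hypergraphs on n vertices. A family of disjoint
    subsets of an n-set is known from its blocks through the n points (and from
    whether it contains the empty set), and each block may be named by one of its
    points: this gives at most 2 (n+1)^n families ([block_code_inj]), hence at
    most 2 (n+1)^n matchings of each size. Only sizes up to n+1 occur, so a
    matching polynomial is one of 2^O(n^2 log n) ([num_iso_classes_le]).

    On the other side, an isomorphism class on n labelled vertices contains at
    most n^n = 2^O(n log n) hypergraphs ([leq_num_iso_classes]), while there are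
    2^(2^n) hypergraphs and 2^C(n,r) r-uniform ones. Both exponents are at least
    C(n,3), of order n^3, once r >= 3 and n >= r + 3. For n large the number of
    unique classes times 2^n is therefore at most the number of all classes
    ([num_iso_classes_exp2_le]), and the quotient is at most 2^-n. *)

Import Order.TTheory GRing.Theory Num.Theory.
Import numFieldNormedType.Exports.

Local Open Scope nat_scope.

(** * Counting families of disjoint sets *)

(** When f factors through g on D, choosing a preimage under g of each value
    of g on D reaches every value of f on D. *)
Lemma leq_card_imset_factor (aT rT cT : finType) (D : {set aT})
    (f : aT -> rT) (g : aT -> cT) :
  {in D &, forall x y, g x = g y -> f x = f y} -> #|f @: D| <= #|g @: D|.
Proof.
(* rT may be empty, so the map from values of g to values of f goes to option. *)
move=> fg; pose h c := omap f [pick x in D | g x == c].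
have some_inj : injective (@Some rT) by move=> x y [].
rewrite -(card_imset _ some_inj).
apply: leq_trans (leq_imset_card h (g @: D)); apply: subset_leq_card.
apply/fintype.subsetP => _ /imsetP[_ /imsetP[x xD ->] ->].
apply/imsetP; exists (g x); first exact: imset_f.
rewrite /h; case: pickP => [y /andP[yD /eqP gyx]|/(_ x)]; last by rewrite xD eqxx.
by rewrite /= (fg y x).
Qed.

(** The successor accounts for the empty set, which is disjoint from itself and
    from all other sets; nonempty disjoint sets each use up a point. *)
Lemma leq_card_trivIset (T : finType) (m : {set {set T}}) :
  finset.trivIset m -> #|m| <= #|T|.+1.
Proof.
move=> tm; rewrite (cardsD1 finset.set0 m) -add1n leq_add ?leq_b1 //.
have tm0 : finset.trivIset (m :\ finset.set0).
  exact: trivIsetS (subD1set _ _) tm.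
apply: leq_trans (max_card (mem (finset.cover (m :\ finset.set0)))).
rewrite -(eqP tm0) -sum1_card leq_sum // => A.
by rewrite in_setD1 card_gt0 => /andP[].
Qed.

Lemma in_pblock_cover (T : finType) (m : {set {set T}}) (u v : T) :
  u \in finset.pblock m v -> v \in finset.cover m.
Proof.
rewrite -mem_pblock /finset.pblock.
by case: pickP => [B /andP[]//|_] /=; rewrite inE.
Qed.

(** The point naming a block is picked from the block alone, hence it is shared
    by all the points of the block; the value None marks the points that no
    member of m contains. *)
Definition block_code (T : finType) (m : {set {set T}}) :
    bool * {ffun T -> option T} :=
  (finset.set0 \in m, [ffun v => [pick u in finset.pblock m v]]).

(** The code recovers each nonempty member of the family from the point that
    names it: v has the name i of A only if its block contains i, and disjointness
    forces this block to be A. *)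
Lemma block_code_fiber (T : finType) (m : {set {set T}}) (A : {set T}) (i : T) :
  finset.trivIset m -> A \in m -> [pick u in A] = Some i ->
  A = [set v | (block_code m).2 v == Some i]%SET.
Proof.
move=> tm Am Ai; apply/setP => v; rewrite inE ffunE.
apply/idP/eqP => [vA|]; first by rewrite (def_pblock tm Am vA).
have iA : i \in A by move: Ai; case: pickP => // x xA [<-].
case: pickP => // u uB [Eu]; rewrite {}Eu in uB.
have vm := in_pblock_cover uB.
by rewrite -(def_pblock tm Am iA) (def_pblock tm (pblock_mem vm) uB) mem_pblock.
Qed.

Lemma block_code_inj (T : finType) :
  {in [pred m : {set {set T}} | finset.trivIset m] &, injective (@block_code T)}.
Proof.
suff sub (m1 m2 : {set {set T}}) : finset.trivIset m1 -> finset.trivIset m2 ->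
    block_code m1 = block_code m2 -> m1 \subset m2.
  move=> m1 m2; rewrite !inE => t1 t2 E; apply/eqP.
  by rewrite finset.eqEsubset !sub.
move=> t1 t2 E; apply/fintype.subsetP => A Am.
have [A0|/set0Pn[v vA]] := eqVneq A finset.set0.
  by have [E0 _] := E; rewrite A0 -E0 -A0.
case Ai: [pick u in A] => [i|]; last by move: Ai; case: pickP => // /(_ v); rewrite vA.
have EA := block_code_fiber t1 Am Ai.
have /eqP : (block_code m2).2 v == Some i by move: vA; rewrite EA inE E.
rewrite ffunE => Bi.
have vm : v \in finset.cover m2.
  by move: Bi; case: pickP => // u /in_pblock_cover.
by rewrite EA E -(block_code_fiber t2 (pblock_mem vm) Bi) pblock_mem.
Qed.

(** * Counting matching polynomials *)

(** The size of the codomain of [block_code] on n points. *)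
Definition trivIset_bound (n : nat) : nat := 2 * n.+1 ^ n.

Lemma num_matchings_le (H : hypergraph) (k : nat) :
  num_matchings H k <= trivIset_bound #|vertex H|.
Proof.
have mP m : m \in matchings H k -> finset.trivIset m.
  by rewrite inE => /and3P[].
rewrite /num_matchings -(@card_in_imset _ _ (@block_code (vertex H))); last first.
  by move=> m1 m2 /mP t1 /mP t2; apply: block_code_inj.
by apply: leq_trans (max_card _) _; rewrite card_prod card_bool card_ffun card_option.
Qed.

Lemma num_matchings_eq0 (H : hypergraph) (k : nat) :
  #|vertex H|.+1 < k -> num_matchings H k = 0.
Proof.
move=> ltk; apply/eqP; rewrite cards_eq0; apply/eqP/setP => m; rewrite !inE.
apply/negP => /and3P[_ /eqP mk /leq_card_trivIset].
by rewrite mk leqNgt ltk.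
Qed.

Lemma coef_matching_poly (H : hypergraph) (k : nat) :
  ((matching_poly H)`_k =
    (if (0 < k <= matching_bound H)%N then num_matchings H k else 0%N)%:Z)%R.
Proof.
rewrite /matching_poly coef_sum.
under eq_bigr do rewrite coefZ coefXn.
case: ifP => [/andP[k0 kb]|kN].
  rewrite (bigD1_seq k) /= ?mem_index_iota ?iota_uniq ?k0 //= eqxx mulr1.
  rewrite big1 ?addr0 ?natz // => i /negPf ik; first by rewrite eq_sym ik mulr0.
rewrite big_seq big1 // => i; rewrite mem_index_iota ltnS.
by case: (eqVneq k i) => [<-|]; rewrite ?kN // mulr0.
Qed.

(** The whole matching polynomial as a point of a finite type: the truncation
    in inord never occurs, by [num_matchings_le], and the degree is at most n+1. *)
Definition matching_code (n : nat) (E : {set {set 'I_n}}) :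
    {ffun 'I_n.+2 -> 'I_(trivIset_bound n).+1} :=
  [ffun k : 'I_n.+2 => inord `|((matching_poly (hyp_on E))`_k)%R|%N].

Lemma matching_code_inj (n : nat) (E F : {set {set 'I_n}}) :
  matching_code E = matching_code F ->
  matching_poly (hyp_on E) = matching_poly (hyp_on F).
Proof.
have small (G : {set {set 'I_n}}) k :
    `|((matching_poly (hyp_on G))`_k)%R|%N < (trivIset_bound n).+1.
  rewrite coef_matching_poly ltnS absz_nat; case: ifP => // _.
  by have := num_matchings_le (hyp_on G) k; rewrite /= card_ord.
move=> EF; apply/polyP => k; have [ltk|lek] := ltnP k n.+2.
  have /(congr1 val) : matching_code E (Ordinal ltk) = matching_code F (Ordinal ltk).
    by rewrite EF.
  rewrite !ffunE /= !inordK ?small //.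
  by rewrite !coef_matching_poly !absz_nat => ->.
by rewrite !coef_matching_poly !num_matchings_eq0 ?if_same //= card_ord.
Qed.

(** * Counting isomorphism classes *)

Lemma isomorphic_refl (H : hypergraph) : isomorphic H H.
Proof. by exists id => [|e]; [exists id | rewrite imset_id]. Qed.

Lemma isomorphic_sym (H1 H2 : hypergraph) : isomorphic H1 H2 -> isomorphic H2 H1.
Proof.
case=> f [g fK gK] fE; exists g => [|e]; first by exists f.
by rewrite fE -imset_comp (eq_imset _ gK) imset_id.
Qed.

Lemma isomorphic_trans (H1 H2 H3 : hypergraph) :
  isomorphic H1 H2 -> isomorphic H2 H3 -> isomorphic H1 H3.
Proof.
move=> [f bf fE] [g bg gE]; exists (g \o f) => [|e]; first exact: bij_comp.
by rewrite fE gE -imset_comp.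
Qed.

(** The hypothesis covers both notions of uniqueness: among the hypergraphs
    satisfying Q, the polynomial determines the class, so that classes are at most
    as numerous as codes. *)
Lemma num_iso_classes_le (n : nat) (Q : hypergraph -> Prop) :
  (forall E F : {set {set 'I_n}}, Q (hyp_on E) -> Q (hyp_on F) ->
     matching_poly (hyp_on E) = matching_poly (hyp_on F) ->
     isomorphic (hyp_on E) (hyp_on F)) ->
  num_iso_classes n Q <= (trivIset_bound n).+1 ^ n.+2.
Proof.
move=> uQ; rewrite /num_iso_classes /equivalence_partition.
apply: leq_trans (leq_card_imset_factor (g := @matching_code n) _) _.
  move=> E F; rewrite !inE => /asboolP QE /asboolP QF.
  move=> /matching_code_inj /(uQ _ _ QE QF) EF.
  apply/setP => G; rewrite !inE; congr andb; apply/asboolP/asboolP.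
    exact/isomorphic_trans/isomorphic_sym.
  exact: isomorphic_trans.
by apply: leq_trans (max_card _) _; rewrite card_ffun !card_ord.
Qed.

(** Every copy of E is the image of E under a self-map of the vertices. All maps
    are counted rather than the bijections only: n^n is easier to compare with
    powers of 2 than n!, and is good enough. *)
Lemma card_isomorphic_le (n : nat) (E : {set {set 'I_n}}) :
  #|[set F : {set {set 'I_n}} | `[< isomorphic (hyp_on E) (hyp_on F) >]]%SET|
    <= n ^ n.
Proof.
pose copy (f : {ffun 'I_n -> 'I_n}) := [set f @: e | e : {set 'I_n} in E]%SET.
apply: leq_trans (_ : #|[set copy f | f in {: {ffun 'I_n -> 'I_n}}]%SET| <= _); last first.
  by apply: leq_trans (leq_imset_card _ _) _; rewrite card_ffun card_ord.
apply: subset_leq_card; apply/fintype.subsetP => F; rewrite inE => /asboolP.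
case=> /= f [g fK gK] fE; apply/imsetP; exists (finfun f) => //.
apply/setP => e.
have ff (A : {set 'I_n}) : finfun f @: A = f @: A by apply: eq_imset => x; rewrite ffunE.
apply/idP/imsetP => [eF|[A AE ->]]; last by rewrite ff -fE.
have fgK : f @: (g @: e) = e by rewrite -imset_comp (eq_imset _ gK) imset_id.
exists (g @: e); last by rewrite ff fgK.
  by rewrite fE fgK.
Qed.

Lemma leq_num_iso_classes (n : nat) (Q : hypergraph -> Prop) :
  #|[set E : {set {set 'I_n}} | `[< Q (hyp_on E) >]]%SET|
    <= num_iso_classes n Q * n ^ n.
Proof.
rewrite /num_iso_classes; set D := [set E | _]%SET; set P := equivalence_partition _ _.
have DP : D \subset finset.cover P.
  apply/fintype.subsetP => E ED; apply/bigcupP; eexists; first exact: imset_f ED.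
  by rewrite inE ED; apply/asboolP/isomorphic_refl.
apply: leq_trans (subset_leq_card DP) _; apply: leq_trans (leq_card_cover P) _.
rewrite -sum_nat_const; apply: leq_sum => _ /imsetP[E _ ->].
apply: leq_trans (card_isomorphic_le E); apply: subset_leq_card.
by apply/fintype.subsetP => F; rewrite !inE => /andP[_ /asboolP].
Qed.

(** * Comparing the two counts *)

(** By symmetry of the binomial coefficients, equality holds on the border
    m + k = n; below it Pascal's rule reduces the claim to n - 1. *)
Lemma leq_bin2r (n m k : nat) : m <= k -> m + k <= n -> 'C(n, m) <= 'C(n, k).
Proof.
elim: n m k => [|n IHn] [|m] [|k] //; rewrite ?bin0 ?bin_gt0; try lia.
move=> mk; rewrite leq_eqVlt => /predU1P[mkn|mkn].
  by rewrite -(@bin_sub n.+1 k.+1) -?mkn ?addnK // leq_addl.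
by rewrite !binS leq_add // IHn //; lia.
Qed.

Lemma card_set_type (T : finType) : #|{: {set T}}| = 2 ^ #|T|.
Proof. by rewrite -(cardsT T) -card_powerset powersetT cardsT. Qed.

Lemma bin3_le_exp2 (n : nat) : 'C(n, 3) <= 2 ^ n.
Proof.
have := card_draws 'I_n 3; rewrite card_ord => <-.
by apply: leq_trans (max_card _) _; rewrite card_set_type card_ord.
Qed.

(** A convenient form of log n = o(n): the logarithm of n+1 in base 2 may be
    replaced by n/16 as soon as 16 (q+1) <= 2^q for q = n/16, that is q >= 7;
    hence 112 = 16 * 7. *)
Lemma succn_le_exp2_div16 (n : nat) : 112 <= n -> n.+1 <= 2 ^ (n %/ 16).
Proof.
move=> n112; have q7 : 7 <= n %/ 16 by rewrite leq_divRL.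
have : n.+1 <= 16 * (n %/ 16).+1 by rewrite mulnC ltn_ceil.
move/leq_trans; apply; elim: (n %/ 16) q7 => // q IH.
rewrite leq_eqVlt => /predU1P[<- //|/IH]; rewrite expnS; lia.
Qed.

(** With L = n/16, so that n+1 <= 2^L, the exponent of 2 on the left is at most
    (L n + 2)(n + 2) + n + L n, roughly n^3/16, and C(n,3) is roughly n^3/6. *)
Lemma matching_code_count_le (n : nat) : 112 <= n ->
  (trivIset_bound n).+1 ^ n.+2 * 2 ^ n * n ^ n <= 2 ^ 'C(n, 3).
Proof.
move=> n112; have nL := succn_le_exp2_div16 n112; set L := n %/ 16 in nL.
have L16 : L * 16 <= n by apply: leq_trunc_div.
have nnL : n.+1 ^ n <= 2 ^ (L * n) by rewrite expnM leq_exp2r //; lia.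
have nn : n ^ n <= 2 ^ (L * n).
  by apply: leq_trans nnL; rewrite leq_exp2r //; lia.
have TL : (trivIset_bound n).+1 <= 2 ^ (L * n + 2).
  rewrite expnD /trivIset_bound.
  have := expn_gt0 2 (L * n); lia.
apply: leq_trans (_ : 2 ^ ((L * n + 2) * n.+2) * 2 ^ n * 2 ^ (L * n) <= _).
  by rewrite !leq_mul // expnM leq_exp2r.
rewrite -!expnD leq_exp2l //.
have b3 : 'C(n, 3) * 6 = n * n.-1 * n.-2 by rewrite (bin_ffact n 3) !ffactnS ffactn0 muln1 mulnA.
suff : ((L * n + 2) * n.+2 + n + L * n) * 6 * 16 <= 'C(n, 3) * 6 * 16 by rewrite !leq_pmul2r.
rewrite b3; clear nL nnL nn TL b3; move: L L16 => L L16.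
case: n n112 L16 => [|[|m]] // m112 L16 /=.
nia.
Qed.

(** Multiplying by n^n lets the left side be bounded by the number of codes and
    the right side be replaced by the number 2^M of labelled hypergraphs. *)
Lemma num_iso_classes_exp2_le (n M : nat) (Q Q' : hypergraph -> Prop) :
  112 <= n -> 'C(n, 3) <= M ->
  (forall E F : {set {set 'I_n}}, Q (hyp_on E) -> Q (hyp_on F) ->
     matching_poly (hyp_on E) = matching_poly (hyp_on F) ->
     isomorphic (hyp_on E) (hyp_on F)) ->
  #|[set E : {set {set 'I_n}} | `[< Q' (hyp_on E) >]]%SET| = 2 ^ M ->
  num_iso_classes n Q * 2 ^ n <= num_iso_classes n Q'.
Proof.
move=> n112 leM uQ cQ'; have nn0 : 0 < n ^ n by rewrite expn_gt0; lia.
rewrite -(leq_pmul2r nn0); apply: leq_trans (leq_num_iso_classes n Q').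
rewrite cQ'; apply: leq_trans (leq_trans (matching_code_count_le n112) _).
  by rewrite !leq_mul // num_iso_classes_le.
by rewrite leq_exp2l.
Qed.

Lemma num_unique_le (n : nat) : 112 <= n ->
  num_unique matching_poly n * 2 ^ n <= num_hyp n.
Proof.
move=> n112; apply: (num_iso_classes_exp2_le n112 (bin3_le_exp2 n)).
  by move=> E F _ uF; apply: uF.
rewrite (_ : [set E | _]%SET = finset.setT) ?cardsT ?card_set_type ?card_ord //.
by apply/setP => E; rewrite !inE; apply/asboolP.
Qed.

Lemma num_runique_le (r n : nat) : 3 <= r -> 3 + r <= n -> 112 <= n ->
  num_runique r matching_poly n * 2 ^ n <= num_runiform r n.
Proof.
move=> r3 rn n112; apply: (num_iso_classes_exp2_le n112 (leq_bin2r r3 rn)).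
  by move=> E F [uE _] [_ uF]; apply: uF.
have := card_draws 'I_n r; rewrite card_ord => <-; rewrite -card_powerset.
apply: eq_card => E; rewrite powersetE inE asboolb.
apply/forall_inP/fintype.subsetP => uE e eE; have := uE e eE; by rewrite inE.
Qed.

Local Open Scope classical_set_scope.
Local Open Scope ring_scope.

Lemma cvg0_of_mul_exp2_le (R : realType) (u v : nat -> nat) (N : nat) :
  (forall n, (N <= n)%N -> (u n * 2 ^ n <= v n)%N) ->
  ((u n)%:R / (v n)%:R : R) @[n --> \oo] --> (0 : R).
Proof.
move=> uv.
apply: (@squeeze_cvgr _ _ _ _ (fun=> 0) (fun n => (2^-1 : R) ^+ n)).
- exists N => // n /= /uv uvn; rewrite divr_ge0 ?ler0n //=.
  have [->|v0] := posnP (v n); first by rewrite invr0 mulr0 exprn_ge0.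
  rewrite ler_pdivrMr ?ltr0n // exprVn mulrC ler_pdivlMr ?exprn_gt0 //.
  by rewrite -natrX -natrM ler_nat.
- exact: cvg_cst.
- by apply: cvg_expr; rewrite ger0_norm ?invf_lt1 ?ltr1n.
Qed.

Theorem theorem5 (R : realType) :
  ((num_unique matching_poly n)%:R / (num_hyp n)%:R : R) @[n --> \oo] --> (0 : R)
  /\
  (forall r : nat, (3 <= r)%N ->
     ((num_runique r matching_poly n)%:R / (num_runiform r n)%:R : R)
       @[n --> \oo] --> (0 : R)).
Proof.
split=> [|r r3]; first exact: cvg0_of_mul_exp2_le num_unique_le.
apply: (@cvg0_of_mul_exp2_le _ _ _ (r + 112)) => n rn.
by apply: num_runique_le => //; lia.
Qed.
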